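(* Let $\Omega$ and $\mathcal{Y}$ be compact Hausdorff spaces and let $\mathbb{P}$ be a probability measure on $\Omega\times\mathcal{Y}$. Let $\mathcal{B}$ be a right-sided reproducing kernel Banach space of functions on $\Omega$ with right-sided reproducing kernel $K\in L_0(\Omega\times\Omega')$ such that $\mathcal{B}$ is reflexive and the right-sided kernel set $\{K(x,\cdot):x\in\Omega\}$ is compact in $\mathcal{B}'$. Let $M>0$, let $B_M:=\{f\in\mathcal{B}:\|f\|_{\mathcal{B}}\le M\}$, and let $E_M$ be the closure of $B_M$ with respect to the uniform norm. Let $L:\Omega\times\mathcal{Y}\times\mathbb{R}\to[0,\infty)$ be a continuous loss function whose derivative $L_t(x,y,t)=\frac{d}{dt}L(x,y,t)$ exists and is continuous, and such that $t\mapsto L(x,y,t)$ is convex for all $x\in\Omega$ and $y\in\mathcal{Y}$. Let $(x_1,y_1),\dots,(x_N,y_N)$ be i.i.d. with distribution $\mathbb{P}$, and let $$\mathcal{L}(f):=\frac1N\sum_{k=1}^NL(x_k,y_k,f(x_k)),\qquad \widetilde{\mathcal{L}}(f):=\int_{\Omega\times\mathcal{Y}}L(x,y,f(x))\,\mathbb{P}(dx,dy),\qquad \tilde r^*:=\inf_{f\in E_M}\widetilde{\mathcal{L}}(f).$$ Let $s$ be a minimizer of $\mathcal{L}$ over $B_M$, i.e. a solution of $\min_{f\in B_M}\mathcal{L}(f)$. Then for any $\epsilon>0$ and any $\tau>0$, $$\mathbb{P}^N\left(\widetilde{\mathcal{L}}(s)\ge\tilde r^*+\kappa_{\epsilon,\tau}\right)\le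 e^{-\tau},\qquad\text{where}\quad \kappa_{\epsilon,\tau}:=\varrho_M\sqrt{\frac{2\tau+2\log N_\epsilon}{N}}+4\epsilon\Upsilon_M .$$
   Context: $\Omega'$ is a locally compact Hausdorff space; $\Omega,\Omega'$ carry regular Borel measures. $L_0(X)$ denotes the set of real-valued measurable functions on $X$ (genuine functions). $\mathbb{L}_\infty(\Omega)$ is the Banach space of all bounded measurable functions on $\Omega$ with the uniform norm $\|f\|_\infty=\sup_{x\in\Omega}|f(x)|$. Right-sided reproducing kernel Banach space: let $K\in L_0(\Omega\times\Omega')$ and let $\mathcal{B}$ be a Banach space consisting of functions in $L_0(\Omega)$ whose continuous dual $\mathcal{B}'$ is isometrically isomorphic to a normed space $\mathcal{F}$ consisting of functions in $L_0(\Omega')$ ($\mathcal{F}$ fixed and identified with $\mathcal{B}'$; $\langle f,G\rangle_{\mathcal{B}}:=G(f)$). $\mathcal{B}$ is a right-sided reproducing kernel Banach space with right-sided reproducing kernel $K$ if (i) $K(x,\cdot)\in\mathcal{F}\cong\mathcal{B}'$ for each $x\in\Omega$, and (ii) $\langle f,K(x,\cdot)\rangle_{\mathcal{B}}=f(x)$ for all $f\in\mathcal{B}$, $x\in\Omega$. $E_M$ is a compact subset of $\mathbb{L}_\infty(\Omega)$. $N_\epsilon\in\mathbb{N}$ is the $\epsilon$-covering number of $E_M$ with respect to the uniform norm, i.e. the smallest number of balls of radius $\epsilon$ in $\mathbb{L}_\infty(\Omega)$ covering $E_M$. $C_\infty:=\sup_{f\in E_M}\|f\|_\infty$. The positive constant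 $\Upsilon_M$ is the smallest Lipschitz constant with $\sup_{x\in\Omega,y\in\mathcal{Y}}|L(x,y,t_1)-L(x,y,t_2)|\le\Upsilon_M|t_1-t_2|$ for all $t_1,t_2\in[-C_\infty,C_\infty]$. The positive constant $\varrho_M$ is the supremum of $L$ on $\Omega\times\mathcal{Y}\times[-C_\infty,C_\infty]$. $\mathbb{P}^N$ is the product measure on $(\Omega\times\mathcal{Y})^N$, extended canonically to the universal completion of the product $\sigma$-algebra. $s$ and $\mathcal{L}$ depend on the random data. *)

(* Defs.v *)
From HB Require Import structures.
From mathcomp Require Import all_boot all_order all_algebra.
From mathcomp Require Import all_classical all_reals all_analysis.
From mathcomp Require Import measurable_realfun.

Set Implicit Arguments.
Unset Strict Implicit.
Unset Printing Implicit Defensive.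

Import Order.TTheory GRing.Theory Num.Theory.
Import numFieldNormedType.Exports.

Local Open Scope classical_set_scope.
Local Open Scope ring_scope.

Notation borel X := (g_sigma_algebraType (@open X)).

(* Real-valued Borel functions.  This is [measurable_fun setT] unfolded on the
   Borel sigma-algebra (see [L0E]), except that the library only equips pointed
   types with a [measurableType] structure, and X may be empty here. *)
Definition L0 (R : realType) (X : topologicalType) : set (X -> R) :=
  [set f | forall A : set R, measurable A -> <<s @open X >> (f @^-1` A)].

Lemma L0E (R : realType) (X : ptopologicalType) (f : X -> R) :
  L0 f <-> measurable_fun [set: borel X] (f : borel X -> R).
Proof.
split=> [Lf _ A mA|mf A mA]; first by rewrite setTI; exact: Lf.
by rewrite -[f @^-1` A]setTI; exact: (mf _ A mA).
Qed.

Section Linfty.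
Variables (R : realType) (X : ptopologicalType).

Definition linf_pred : {pred X -> R^o} :=
  mem [set f : X -> R^o | L0 (f : X -> R) /\ bounded_fun f].

Record Linfty := MkLinfty {
  linf_fun :> X -> R^o;
  linf_funP : linf_fun \in linf_pred }.

HB.instance Definition _ := [isSub for linf_fun].
HB.instance Definition _ := [Choice of Linfty by <:].

Lemma linf_submod_closed : submod_closed linf_pred.
Proof.
split.
  rewrite inE; split; first by apply/L0E; exact: measurable_cst.
  by exists 0; split => // x x0 y _ /=; rewrite normr0 ltW.
move=> a f g; rewrite !inE => -[mf bf] [mg bg]; split.
  apply/L0E; move/L0E in mf; move/L0E in mg.
  by apply: measurable_funD => //; exact: measurable_funM.
have [M [_ Mf]] := bf; have [N [_ Ng]] := bg.
exists (`|a| * (M + 1) + (N + 1)); split; first exact: num_real.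
move=> z /ltW zge x _ /=; apply: le_trans zge.
rewrite (le_trans (ler_normD _ _))// normrM lerD ?ler_wpM2l//.
  by apply: Mf => //; rewrite ltrDl.
by apply: Ng => //; rewrite ltrDl.
Qed.

HB.instance Definition _ := GRing.isSubmodClosed.Build _ _ linf_pred
  linf_submod_closed.
HB.instance Definition _ := [SubChoice_isSubLmodule of Linfty by <:].

Definition linf_norm (f : Linfty) : R := sup (range (fun x => `|f x|)).

Lemma linf_has_sup (f : Linfty) : has_sup (range (fun x => `|f x|)).
Proof.
split; first by exists `|f point|, point.
have := linf_funP f; rewrite inE => -[_ [M [_ Mf]]].
by exists (M + 1) => _ [x _ <-]; apply: Mf => //; rewrite ltrDl.
Qed.

Lemma linf_norm_ge (f : Linfty) x : `|f x| <= linf_norm f.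
Proof. by apply: sup_upper_bound; [exact: linf_has_sup|exists x]. Qed.

Lemma linf_norm_le (f : Linfty) c : (forall x, `|f x| <= c) -> linf_norm f <= c.
Proof.
move=> fc; apply: ge_sup; first exact: (linf_has_sup f).1.
by move=> _ [x _ <-].
Qed.

Lemma linf_normD (f g : Linfty) : linf_norm (f + g) <= linf_norm f + linf_norm g.
Proof.
apply: linf_norm_le => x.
by rewrite (le_trans (ler_normD _ _))// lerD// linf_norm_ge.
Qed.

Lemma linf_normZ (a : R) (f : Linfty) : linf_norm (a *: f) = `|a| * linf_norm f.
Proof.
apply/eqP; rewrite eq_le; apply/andP; split.
  by apply: linf_norm_le => x; rewrite normrM ler_wpM2l// linf_norm_ge.
have [->|a0] := eqVneq a 0.
  by rewrite normr0 mul0r (le_trans _ (linf_norm_ge _ point)).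
rewrite mulrC -ler_pdivlMr ?normr_gt0//; apply: linf_norm_le => x.
rewrite ler_pdivlMr ?normr_gt0// mulrC -normrM.
exact: (linf_norm_ge (a *: f) x).
Qed.

Lemma linf_norm0_eq0 (f : Linfty) : linf_norm f = 0 -> f = 0.
Proof.
move=> f0; apply: val_inj; apply/funext => x; apply/eqP.
by rewrite -normr_le0 -f0; exact: linf_norm_ge.
Qed.

HB.instance Definition _ := @Lmodule_isNormed.Build R Linfty linf_norm
  linf_normD linf_normZ linf_norm0_eq0.

End Linfty.

Section dual.
Variables (R : realType) (V : normedModType R).

Definition dual_pred : {pred V -> R^o} :=
  mem [set f : V -> R^o | linear f /\ continuous f].

Record dual := MkDual {
  dual_fun :> V -> R^o;
  dual_funP : dual_fun \in dual_pred }.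

HB.instance Definition _ := [isSub for dual_fun].
HB.instance Definition _ := [Choice of dual by <:].

Lemma dual_submod_closed : submod_closed dual_pred.
Proof.
split.
  rewrite inE; split; last by move=> x; exact: cvg_cst.
  by move=> a x y /=; rewrite scaler0 addr0.
move=> a f g; rewrite !inE => -[lf cf] [lg cg]; split.
  move=> b x y /=.
  change (a *: f (b *: x + y) + g (b *: x + y) =
          b *: (a *: f x + g x) + (a *: f y + g y)).
  by rewrite lf lg !scalerDr !scalerA (mulrC a b) addrACA.
by move=> x; apply: cvgD; [apply: cvgZr; exact: cf|exact: cg].
Qed.

HB.instance Definition _ := GRing.isSubmodClosed.Build _ _ dual_pred
  dual_submod_closed.
HB.instance Definition _ := [SubChoice_isSubLmodule of dual by <:].

Definition dual_norm (G : dual) : R :=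
  sup [set `|G f| | f in [set f : V | `|f| <= 1]].

Lemma dual_linear (G : dual) : linear G.
Proof. by have := dual_funP G; rewrite inE => -[]. Qed.

Lemma dual_has_sup (G : dual) :
  has_sup [set `|G f| | f in [set f : V | `|f| <= 1]].
Proof.
split; first by exists `|G 0|, 0 => //=; rewrite normr0.
have := dual_funP G; rewrite inE => -[lG cG].
pose G' : {linear V -> R^o} := HB.pack (G : V -> R^o)
  (GRing.isLinear.Build _ _ _ _ _ lG).
have /linear_bounded_continuous/bounded_funP/(_ 1)[M GM] : continuous G' by [].
by exists M => _ [f f1 <-]; exact: GM.
Qed.

Lemma dual_norm_ge (G : dual) f : `|f| <= 1 -> `|G f| <= dual_norm G.
Proof. by move=> f1; apply: sup_upper_bound; [exact: dual_has_sup|exists f]. Qed.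

Lemma dual_norm_le (G : dual) c :
  (forall f, `|f| <= 1 -> `|G f| <= c) -> dual_norm G <= c.
Proof.
move=> fc; apply: ge_sup; first exact: (dual_has_sup G).1.
by move=> _ [x x1 <-]; exact: fc.
Qed.

Lemma dual_normD (G H : dual) : dual_norm (G + H) <= dual_norm G + dual_norm H.
Proof.
apply: dual_norm_le => f f1.
by rewrite (le_trans (ler_normD _ _))// lerD// dual_norm_ge.
Qed.

Lemma dual_normZ (a : R) (G : dual) : dual_norm (a *: G) = `|a| * dual_norm G.
Proof.
apply/eqP; rewrite eq_le; apply/andP; split.
  by apply: dual_norm_le => f f1; rewrite normrM ler_wpM2l// dual_norm_ge.
have [->|a0] := eqVneq a 0.
  rewrite normr0 mul0r (le_trans _ (@dual_norm_ge _ 0 _))//.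
  by rewrite normr0.
rewrite mulrC -ler_pdivlMr ?normr_gt0//; apply: dual_norm_le => f f1.
rewrite ler_pdivlMr ?normr_gt0// mulrC -normrM.
exact: (@dual_norm_ge (a *: G) f).
Qed.

Lemma dual_norm0_eq0 (G : dual) : dual_norm G = 0 -> G = 0.
Proof.
move=> G0; apply: val_inj; apply/funext => f /=; apply/eqP.
have lG := dual_linear G.
pose G' : {linear V -> R^o} := HB.pack (G : V -> R^o)
  (GRing.isLinear.Build _ _ _ _ _ lG).
have [->|f0] := eqVneq f 0; first by apply/eqP; exact: (linear0 G').
have nf0 : 0 < `|f| by rewrite normr_gt0.
have : `|G (`|f|^-1 *: f)| <= 0.
  rewrite -G0; apply: dual_norm_ge.
  by rewrite normrZ normfV normr_id mulVf// gt_eqF.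
rewrite normr_le0 [X in X == _](linearZ_LR G') scaler_eq0 invr_eq0 (gt_eqF nf0).
by [].
Qed.

HB.instance Definition _ := @Lmodule_isNormed.Build R dual dual_norm
  dual_normD dual_normZ dual_norm0_eq0.

End dual.

(* Surjectivity of the canonical embedding of V into its bidual. *)
Definition reflexive_space (R : realType) (V : normedModType R) : Prop :=
  forall Phi : dual (dual V), exists f : V, forall G : dual V, Phi G = G f.

(* [ev] presents the vector space V as a space of measurable functions on X:
   [ev f] is the function that the vector f is. *)
Definition function_space (R : realType) (X : topologicalType) (V : lmodType R)
    (ev : V -> (X -> R^o)) : Prop :=
  [/\ linear ev, injective ev & forall f, L0 (ev f : X -> R)].

Section right_sided_RKBS.
Variables (R : realType) (Om Om' : topologicalType).
Variables (B : completeNormedModType R) (evB : B -> (Om -> R^o)).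
Variables (F : normedModType R) (evF : F -> (Om' -> R^o)).
Variables (iota : F -> dual B) (K : Om * Om' -> R).

Definition isometric_isomorphism : Prop :=
  [/\ linear iota, bijective iota & forall g, `|iota g| = `|g| ].

Record right_sided_RKBS : Prop := {
  rkbs_B : function_space evB;
  rkbs_F : function_space evF;
  rkbs_iso : isometric_isomorphism;
  rkbs_K : L0 K;
  rkbs_reproducing : forall x, exists2 g : F,
    evF g = (fun y => K (x, y)) & forall f : B, iota g f = evB f x }.

Definition right_kernel_set : set (dual B) :=
  [set iota g | g in [set g : F | exists x, evF g = (fun y => K (x, y))]].

End right_sided_RKBS.

Section product_measure.
Context d (T : measurableType d) (R : realType) (P : probability T R).
Local Open Scope ereal_scope.

Definition consT n (z : T * n.-tuple T) : n.+1.-tuple T :=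
  [the n.+1.-tuple T of z.1 :: z.2].

Lemma measurable_consT n : measurable_fun setT (@consT n).
Proof. by apply: measurable_cons. Qed.

HB.instance Definition _ n :=
  isMeasurableFun.Build _ _ _ _ (@consT n) (@measurable_consT n).

(* The N-fold product of P, on the product sigma-algebra of T^N. *)
Fixpoint power_measure (N : nat) : probability (N.-tuple T) R :=
  if N is N'.+1 then
    distribution (P \x power_measure N') (@consT N')
  else \d_([tuple] : 0.-tuple T).

Lemma power_measureE N (A : 'I_N -> set T) : (forall i, measurable (A i)) ->
  power_measure N [set z | forall i, A i (tnth z i)] = \prod_(i < N) P (A i).
Proof.
elim: N A => [|N IH] A mA.
  rewrite big_ord0 /= diracE mem_set//= => -[]//.
rewrite big_ord_recl -IH; last by move=> i; exact: mA.
rewrite /= /distribution /pushforward.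
rewrite -product_measure1E//; last first.
  rewrite [X in measurable X](_ : _ =
    \bigcap_(i in [set: 'I_N]) ((fun z => tnth z i) @^-1` A (lift ord0 i))).
    apply: fin_bigcap_measurable => // i _.
    by rewrite -[X in measurable X]setTI; exact: measurable_tnth.
  by apply/seteqP; split=> z /= h i; [move=> _; exact: h|exact: (h i Logic.I)].
congr (product_measure1 _ _ _); apply/seteqP; split=> -[x z] /=.
  by move=> h; split=> [|i]; [have := h ord0|have := h (lift ord0 i); rewrite tnthS].
move=> [h0 h] i; case: (unliftP ord0 i) => [j ->|->]; last exact: h0.
by rewrite tnthS; exact: h.
Qed.

End product_measure.

Section universal_completion.
Context d (T : measurableType d) (R : realType).
Local Open Scope ereal_scope.

Definition universally_measurable (A : set T) : Prop :=
  forall Q : probability T R, exists A1 A2 : set T,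
    [/\ measurable A1, measurable A2, A1 `<=` A, A `<=` A2 & Q (A2 `\` A1) = 0].

(* The canonical extension of P beyond the sigma-algebra: on the universal
   completion it is the completion of P (see [extensionE]); elsewhere it is the
   outer measure, so that [extension P A <= c] is meaningful for every event A,
   and says that A is included in measurable sets of measure arbitrarily close
   to being at most c. *)
Definition extension (P : probability T R) (A : set T) : \bar R := (P^*)%mu A.

Lemma extensionE (P : probability T R) (A A1 A2 : set T) :
  measurable A1 -> measurable A2 -> A1 `<=` A -> A `<=` A2 ->
  P (A2 `\` A1) = 0 -> extension P A = P A1 /\ extension P A = P A2.
Proof.
move=> m1 m2 s1 s2 P0.
have P12 : P A2 = P A1.
  rewrite -(setDKU (subset_trans s1 s2)) measureU//=.
  - by rewrite [X in X + _ = _](_ : _ = 0)// add0e.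
  - exact: measurableD.
  - by rewrite setDE -setIA setICl setI0.
have l1 : P A1 <= extension P A.
  by rewrite -(measurable_mu_extE P m1); exact: le_mu_ext.
have l2 : extension P A <= P A2.
  by rewrite -(measurable_mu_extE P m2); exact: le_mu_ext.
by split; apply/eqP; rewrite eq_le ?l1 ?l2 -?P12 ?l2 // P12 l1.
Qed.

Lemma universally_measurable_extension (A : set T) (P : probability T R) :
  universally_measurable A -> exists A1 A2 : set T,
    [/\ measurable A1, measurable A2, A1 `<=` A, A `<=` A2 &
        extension P A = P A1 /\ extension P A = P A2].
Proof.
move=> /(_ P)[A1 [A2 [m1 m2 s1 s2 P0]]]; exists A1, A2; split => //.
exact: extensionE.
Qed.

End universal_completion.

(* The closed ball is written out: the library's [closed_ball] is the closure of
   the open ball. *)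
Definition covers (R : realType) (V : normedModType R) (E : set V) (e : R)
    (n : nat) : Prop :=
  exists c : 'I_n -> V, forall f, E f -> exists i, `|c i - f| <= e.

(* Junk value 0 when E has no finite cover. *)
Definition covering_number (R : realType) (V : normedModType R) (E : set V)
    (e : R) : nat :=
  xget 0%N [set n | covers E e n /\ forall m, covers E e m -> (n <= m)%N].

Section learning.
Variables (R : realType) (Om Y : ptopologicalType).
Variables (B : normedModType R) (evB : B -> (Om -> R^o)).
Variables (L : Om -> Y -> R -> R).

Definition admissible_loss : Prop :=
  [/\ forall x y t, 0 <= L x y t,
      continuous (fun p : Om * Y * R => L p.1.1 p.1.2 p.2),
      forall x y t, derivable (L x y : R^o -> R^o) t 1,
      continuous (fun p : Om * Y * R => derive1 (L p.1.1 p.1.2 : R^o -> R^o) p.2) &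
      forall x y, convex_function [set: R^o] (L x y)].

(* B_M as a subset of L_infty; that all its members are bounded is automatic
   when the kernel set is compact. *)
Definition ball_in_Linfty (M : R) : set (Linfty R Om) :=
  [set g | exists2 f : B, `|f| <= M & evB f = g].

Definition E_M (M : R) : set (Linfty R Om) := closure (ball_in_Linfty M).

Definition Cinf (M : R) : R := sup [set `|g| | g in E_M M].

Definition lip_const (M : R) : R :=
  inf [set c : R | 0 <= c /\ forall x y t1 t2,
    t1 \in `[- Cinf M, Cinf M] -> t2 \in `[- Cinf M, Cinf M] ->
    `|L x y t1 - L x y t2| <= c * `|t1 - t2| ].

Definition loss_sup (M : R) : R :=
  sup [set r | exists x y t, t \in `[- Cinf M, Cinf M] /\ r = L x y t].

Definition emp_risk (N : nat) (z : N.-tuple (Om * Y)) (f : Om -> R) : R :=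
  N%:R^-1 * \sum_(k < N) L (tnth z k).1 (tnth z k).2 (f (tnth z k).1).

(* Extended-real valued, so that it makes sense for every f without any
   integrability assumption. *)
Definition risk (P : probability (borel (Om * Y)%type) R) (f : Om -> R) : \bar R :=
  (\int[P]_z (L (z : Om * Y).1 (z : Om * Y).2 (f (z : Om * Y).1))%:E)%E.

Definition opt_risk (P : probability (borel (Om * Y)%type) R) (M : R) : \bar R :=
  ereal_inf [set risk P g | g in E_M M].

Definition is_minimizer (N : nat) (z : N.-tuple (Om * Y)) (M : R) (s : B) : Prop :=
  `|s| <= M /\ forall f : B, `|f| <= M -> emp_risk z (evB s) <= emp_risk z (evB f).

Definition kappa (N : nat) (M eps tau : R) : R :=
  loss_sup M *
    Num.sqrt ((2 * tau + 2 * ln (covering_number (E_M M) eps)%:R) / N%:R)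
  + 4 * eps * lip_const M.

End learning.

(* Main.v *)
(* Fix a near-minimizer f0 of the risk in the ball and an eps-net (c_i) of E_M
   whose members are clipped to [-C_oo, C_oo], which keeps the covering property
   and makes the bounds on L applicable.  The minimizer s is eps-close to some
   c_i, and has empirical risk at most that of f0, so a large excess risk of s
   forces the deviation of the mean of L(c_i) - L(f0) from its empirical mean to
   be at least rho sqrt((2 tau + 2 log N_eps) / N) for that i.  Taking the
   difference with f0 before applying Hoeffding's inequality (to a variable with
   values in [-rho, rho]) makes the deviation one-sided, hence a union bound over
   the N_eps centers without a factor 2.  The slack of the constant 4 in
   4 eps Upsilon pays for f0 being only a near-minimizer.  The net exists because
   f(x) = <f, K(x, .)>, so that finitely many kernels control all evaluations. *)
Require Import Defs.
From HB Require Import structures.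
From mathcomp Require Import all_boot all_order all_algebra.
From mathcomp Require Import all_classical all_reals all_analysis.
From mathcomp Require Import measurable_realfun finmap ring lra.
Set Implicit Arguments.
Unset Strict Implicit.
Unset Printing Implicit Defensive.
Import Order.TTheory GRing.Theory Num.Theory.
Import numFieldNormedType.Exports.
Local Open Scope classical_set_scope.
Local Open Scope ring_scope.

(** * Hoeffding's inequality for the product measure *)

(* The logarithmic derivative of [expR (u ^+ 2 / 2 - u * m) / c u], with [c] the
   left-hand side, is [u - m - c' u / c u]; as [c'' = c], its own derivative is
   [(c' / c) ^+ 2]. *)
Lemma expR_two_point_le (R : realType) (m u : R) : -1 <= m <= 1 -> 0 <= u ->
  (1 - m) / 2 * expR u + (1 + m) / 2 * expR (- u) <= expR (u ^+ 2 / 2 - u * m).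
Proof.
move=> /andP[m1 m2] u0.
pose c (v : R) : R := (1 - m) / 2 * expR v + (1 + m) / 2 * expR (- v).
pose c' (v : R) : R := (1 - m) / 2 * expR v - (1 + m) / 2 * expR (- v).
have c_gt0 v : 0 < c v.
  have e1 := expR_gt0 v; have e2 := expR_gt0 (- v).
  (* Both weights are nonnegative and one of them is at least 1/2: the first when [m <= 0], the
     second otherwise. *)
  rewrite /c; have [m0|m0] := leP m 0.
    by apply: ltr_wpDr; [apply: mulr_ge0 => //; lra|apply: mulr_gt0 => //; lra].
  by apply: ltr_wpDl; [apply: mulr_ge0 => //; lra|apply: mulr_gt0 => //; lra].
have c_neq0 v : c v != 0 by rewrite gt_eqF.
have dc (v : R) : is_derive v 1 (c : R -> R) (c' v).
  rewrite /c /c'; apply: is_derive_eq; rewrite /GRing.scale/=; ring.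
have dc' (v : R) : is_derive v 1 (c' : R -> R) (c v).
  rewrite /c /c'; apply: is_derive_eq; rewrite /GRing.scale/=; ring.
pose w (v : R) : R := v - m - c' v * (c v)^-1.
have dw (v : R) : is_derive v 1 (w : R -> R) ((c' v / c v) ^+ 2).
  rewrite /w.
  have dV := is_deriveV (c_neq0 v) (dc v).
  have dM := is_deriveM (dc' v) dV.
  apply: is_derive_eq. rewrite /GRing.scale/=.
  have := c_neq0 v; move: (c v) (c' v) => a b a0; field.
  by rewrite a0.
have cont (f f' : R -> R) : (forall v : R, is_derive v 1 f (f' v)) ->
    {within `[0, +oo[, continuous f}.
  move=> df; apply: continuous_subspaceT => x.
  by apply/differentiable_continuous/derivable1_diffP.
have w_ge0 v : 0 <= v -> 0 <= w v.
  (* [c 0 = 1] and [c' 0 = - m]. *)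
  move=> v0; have <- : w 0 = 0.
    by rewrite /w /c /c' oppr0 expR0; field; lra.
  apply: (@ger0_derive1_ndecry R w 0) => //; last exact: cont dw.
  by move=> x _; rewrite derive1E derive_val sqr_ge0.
pose q (v : R) : R := v ^+ 2 / 2 - v * m.
have dq (v : R) : is_derive v 1 (q : R -> R) (v - m).
  by rewrite /q; apply: is_derive_eq; rewrite /GRing.scale/=; field.
pose g (v : R) : R := expR (q v) * (c v)^-1.
have dg (v : R) : is_derive v 1 (g : R -> R) (g v * w v).
  have dE : is_derive v 1 (expR \o q) ((v - m) * expR (q v)).
    by apply: is_derive_eq; rewrite mulrC.
  have dV := is_deriveV (c_neq0 v) (dc v).
  have dM := is_deriveM dE dV.
  apply: is_derive_eq; rewrite /GRing.scale/= /g /w.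
  have := c_neq0 v; move: (c v) (c' v) => a b a0; field.
  by rewrite a0.
have : g 0 <= g u.
  apply: (@ger0_derive1_ndecry R g 0) => //.
    move=> x; rewrite in_itv/= andbT => x0.
    by rewrite derive1E derive_val mulr_ge0 ?w_ge0 ?divr_ge0 ?expR_ge0 ?ltW.
  exact: cont dg.
rewrite /g ler_pdivlMr ?c_gt0// => h.
apply: le_trans h; rewrite /q /c !expr0n/= mul0r mul0r subr0 oppr0 expR0.
rewrite (_ : (1 - m) / 2 * 1 + (1 + m) / 2 * 1 = 1) ?divr1 ?mul1r//.
by field.
Qed.

(** Convexity of [expR]: [- (u * x)] is the average of [u] and [- u] with weights [(1 - x) / 2] and
    [(1 + x) / 2]. *)
Lemma expR_chord_le (R : realType) (u x : R) : -1 <= x <= 1 ->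
  expR (- (u * x)) <= (1 - x) / 2 * expR u + (1 + x) / 2 * expR (- u).
Proof.
move=> /andP[x1 x2].
have t0 : 0 <= (1 + x) / 2 by lra.
have t1 : (1 + x) / 2 <= 1 by lra.
have := convex_expR (Itv01 t0 t1) (- u) u.
rewrite !convRE /= (_ : unstable.onem _ = (1 - x) / 2); last first.
  by rewrite /unstable.onem; field.
rewrite (_ : _ * - u + _ = - (u * x)); last by field.
by rewrite addrC.
Qed.
(** The chord bound is affine in [h x], so its integral depends only on the mean of [h], and the
    two-point inequality bounds the result. Using the range [[-rho, rho]] of [h], rather than a
    bound on the centered variable, yields the constant 1/2 in the exponent. *)
Lemma hoeffding_mgf d (T : measurableType d) (R : realType) (P : probability T R)
    (h : T -> R) (rho lam : R) :
  measurable_fun setT h -> 0 < rho -> (forall x, `|h x| <= rho) -> 0 <= lam ->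
  (\int[P]_x (expR (lam * (\int[P]_y h y - h x)))%:E <=
   (expR (lam ^+ 2 * rho ^+ 2 / 2))%:E)%E.
Proof.
move=> mh rho0 hrho lam0.
have ih : P.-integrable setT (EFin \o h).
  apply: measurable_bounded_integrable => //.
    by rewrite /= probability_setT ltry.
  exists rho; split=> [|y /ltW ry x _ /=]; first exact: num_real.
  exact: le_trans ry.
set e := (\int[P]_y h y)%R.
have e_bnd : `|e| <= rho.
  apply: le_trans (le_normr_Rintegral _ ih) _ => //.
  apply: (@le_trans _ _ (\int[P]_y (cst rho) y)%R).
    apply: le_Rintegral => //; first exact: integrable_norm.
    exact: finite_measure_integrable_cst.
  by rewrite Rintegral_cst//= probability_setT mulr1.
pose u := lam * rho; pose m := e / rho.
have m1 : -1 <= m <= 1.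
  by rewrite -ler_norml /m normrM normfV (gtr0_norm rho0) ler_pdivrMr// mul1r.
(* [a + b * h x] is the right-hand side of [expR_chord_le] at [h x / rho], times [expR (u * m)],
   with the terms in [h x] collected. *)
pose b := (expR (- u) - expR u) / (2 * rho) * expR (u * m).
pose a := (expR (- u) + expR u) / 2 * expR (u * m).
have pw x : expR (lam * (e - h x)) <= a + b * h x.
  have x1 : -1 <= h x / rho <= 1.
    by rewrite -ler_norml normrM normfV (gtr0_norm rho0) ler_pdivrMr// mul1r.
  have -> : lam * (e - h x) = - (u * (h x / rho)) + u * m.
    by rewrite /u /m; field; rewrite gt_eqF.
  rewrite expRD.
  apply: le_trans (ler_wpM2r (expR_ge0 _) (expR_chord_le u x1)) _.
  rewrite le_eqVlt; apply/orP; left; apply/eqP.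
  by rewrite /a /b; field; rewrite gt_eqF.
have iab : P.-integrable setT (EFin \o (fun x => a + b * h x)).
  apply: (@integrableD _ _ _ _ _ _ (cst a%:E)
    (fun x => b%:E * (h x)%:E)%E) => //.
    exact: finite_measure_integrable_cst.
  exact: integrableZl.
have -> : lam ^+ 2 * rho ^+ 2 / 2 = u ^+ 2 / 2 - u * m + u * m.
  by rewrite /u; field.
apply: (@le_trans _ _ (\int[P]_x (a + b * h x)%:E)%E).
  apply: ge0_le_integral => //.
  - apply/measurable_EFinP; apply: measurableT_comp => //.
    by apply: measurable_funM => //; apply: measurable_funB.
  - by apply/measurable_EFinP; apply: measurable_funD => //; apply: measurable_funM.
  - by move=> x _; rewrite lee_fin.
have -> : (\int[P]_x (a + b * h x)%:E = (a + b * e)%:E)%E.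
  rewrite -[LHS]fineK; last exact: integrable_fin_num.
  congr EFin; rewrite -[LHS]/(\int[P]_x (a + b * h x))%R RintegralD//.
  - by rewrite Rintegral_cst//= probability_setT mulr1 RintegralZl.
  - exact: finite_measure_integrable_cst.
  - exact: (integrableZl _ b ih).
rewrite lee_fin expRD.
apply: le_trans (ler_wpM2r (expR_ge0 _) (expR_two_point_le m1 _)); last first.
  by rewrite mulr_ge0// ltW.
rewrite le_eqVlt; apply/orP; left; apply/eqP.
by rewrite /a /b /m; field; rewrite gt_eqF.
Qed.

(** Independence of the coordinates: Tonelli splits off the first one, and induction handles the
    tail. *)
Lemma integral_power_measure_prod d (T : measurableType d) (R : realType)
    (P : probability T R) (N : nat) (phi : 'I_N -> T -> R) :
  (forall i, measurable_fun setT (phi i)) -> (forall i x, 0 <= phi i x) ->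
  (\int[power_measure P N]_z (\prod_(i < N) phi i (tnth z i))%:E =
   \prod_(i < N) \int[P]_x (phi i x)%:E)%E.
Proof.
elim: N phi => [|N IH] phi mphi phi0 /=.
  rewrite big_ord0 integral_dirac//=.
    by rewrite diracT mul1e big_ord0.
  by under eq_fun do rewrite big_ord0; exact: measurable_cst.
have mprod n (psi : 'I_n -> T -> R) : (forall i, measurable_fun setT (psi i)) ->
    measurable_fun setT
      (fun z : n.-tuple T => (\prod_(i < n) psi i (tnth z i))%:E).
  move=> mpsi; apply/measurable_EFinP; apply: measurable_prod => i _.
  apply: measurableT_comp => //; exact: measurable_tnth.
rewrite ge0_integral_distribution//; last 2 first.
- exact: mprod.
- by move=> z; rewrite lee_fin prodr_ge0.
have mcomp := measurableT_comp (mprod _ _ mphi)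
  (measurable_consT (T:=T) (n:=N)).
rewrite fubini_tonelli1//; last first.
  by move=> z; rewrite lee_fin prodr_ge0.
rewrite big_ord_recl -(IH (fun i => phi (lift ord0 i)))//.
set q := (\int[power_measure P N]_z _)%E.
transitivity (\int[P]_x ((phi ord0 x)%:E * q))%E; last first.
  rewrite ge0_integralZr//; first exact/measurable_EFinP.
    by move=> x _; rewrite lee_fin.
  by apply: integral_ge0 => z _; rewrite lee_fin prodr_ge0.
apply: eq_integral => x _; rewrite /q -ge0_integralZl//; last 3 first.
- exact: (mprod _ (fun i => phi (lift ord0 i))).
- by move=> z _; rewrite lee_fin prodr_ge0.
- by rewrite lee_fin.
apply: eq_integral => z _; rewrite /= big_ord_recl /= EFinM.
by congr (_ * (_)%:E)%E; apply: eq_bigr => i _; rewrite tnthS.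
Qed.

Lemma measurable_empirical_mean d (T : measurableType d) (R : realType)
    (N : nat) (h : T -> R) : measurable_fun setT h ->
  measurable_fun setT
    (fun z : N.-tuple T => N%:R^-1 * \sum_(k < N) h (tnth z k)).
Proof.
move=> mh; apply: measurable_funM => //; apply: measurable_sum => k.
by apply: measurableT_comp => //; exact: measurable_tnth.
Qed.

(** Chernoff's bound with parameter [lam * N]: the moment generating function factors over the
    coordinates, and [hoeffding_mgf] bounds each factor. *)
Lemma hoeffding d (T : measurableType d) (R : realType) (P : probability T R)
    (N : nat) (h : T -> R) (rho t : R) :
  measurable_fun setT h -> (forall x, `|h x| <= rho) -> 0 < rho ->
  (0 < N)%N -> 0 < t ->
  (power_measure P N
     [set z | (t <= \int[P]_x h x - N%:R^-1 * \sum_(k < N) h (tnth z k))%R] <=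
   (expR (- (N%:R * t ^+ 2 / (2 * rho ^+ 2))))%:E)%E.
Proof.
move=> mh hrho rho0 N0 t0; set e := (\int[P]_x h x)%R.
have N0' : 0 < N%:R :> R by rewrite ltr0n.
pose S (z : N.-tuple T) : R := e - N%:R^-1 * \sum_(k < N) h (tnth z k).
have mS : measurable_fun setT S.
  by apply: measurable_funB => //; exact: measurable_empirical_mean.
pose X : {RV (power_measure P N) >-> R} := mfun_Sub (mem_set mS).
(* Minimizes the Chernoff exponent [N lam ^+ 2 rho ^+ 2 / 2 - N lam t]. *)
pose lam := t / rho ^+ 2.
have lam0 : 0 < lam by rewrite divr_gt0// exprn_gt0.
have NX (z : N.-tuple T) :
    S z * (lam * N%:R) = \sum_(k < N) lam * (e - h (tnth z k)).
  rewrite -mulr_sumr sumrB sumr_const card_ord /S mulrC -mulrA mulrBr.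
  by rewrite mulVKf ?gt_eqF// mulr_natl.
have := chernoff X t (mulr_gt0 lam0 N0').
rewrite [X in (X <= _)%E -> _](_ : _ =
  power_measure P N [set z | (t <= S z)%R]); last by [].
move/le_trans; apply.
rewrite /mmt_gen_fun unlock.
have -> : (\int[power_measure P N]_z
    ((expR \o (lam * N%:R) \o* X) z)%:E)%E =
  (\int[power_measure P N]_z
    (\prod_(k < N) expR (lam * (e - h (tnth z k))))%:E)%E.
  by apply: eq_integral => z _ /=; rewrite NX expR_sum.
rewrite (@integral_power_measure_prod _ _ _ P N
  (fun _ x => expR (lam * (e - h x)))).
- have := hoeffding_mgf P mh rho0 hrho (ltW lam0).
  set I := (\int[P]_x _)%E; set c := expR _ => Ic.
  have I0 : (0 <= I)%E by apply: integral_ge0 => x _; rewrite lee_fin expR_ge0.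
  (* Finiteness allows the comparison of [N]-th powers to take place in the reals. *)
  have If : I \is a fin_num by rewrite ge0_fin_numE// (le_lt_trans Ic) ?ltry.
  move: Ic I0; rewrite -(fineK If) !lee_fin => Ic I0.
  rewrite prodEFin lee_fin prodr_const card_ord.
  apply: (@le_trans _ _ (c ^+ N * expR (- (lam * N%:R * t)))).
    by rewrite ler_wpM2r ?expR_ge0// lerXn2r ?nnegrE ?expR_ge0.
  rewrite -expRM_natl -expRD ler_expR le_eqVlt; apply/orP; left; apply/eqP.
  by rewrite /lam; field; rewrite gt_eqF.
- move=> _; apply: measurableT_comp => //; apply: measurable_funM => //.
  exact: measurable_funB.
- by move=> _ x; exact: expR_ge0.
Qed.

(** * Borel measurability of the loss along a measurable function *)

(* The second factor is second countable, so open sets of the product are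
   countable unions of open rectangles even when [X] is not second countable. *)
Lemma measurable_continuous_graph (R : realType) (X : ptopologicalType)
    (G : X * R -> R) (g : X -> R) :
  continuous G -> L0 g -> L0 (fun x => G (x, g x)).
Proof.
move=> cG /L0E mg; apply/L0E.
apply: (measurability _ (RGenOInfty.measurableE R)) => _ [_ [r ->] <-].
rewrite setTI.
pose U := [set p | r < G p].
have oU : open U.
  by have /continuousP/(_ [set y | r < y]) := cG; apply; exact: open_gt.
(* The points whose whole slice over a ball with rational center and radius lies in [U]; taking the
   interior makes this set open. *)
pose V (q : rat * rat) : set X :=
  interior [set x | forall t, ball (ratr q.1 : R) (ratr q.2) t -> U (x, t)].
rewrite [X in measurable X](_ : _ =
  \bigcup_q (V q `&` g @^-1` ball (ratr q.1 : R) (ratr q.2))).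
  apply: countable_bigcupT_measurable; first exact: countableP.
  move=> q; apply: measurableI.
    by apply: sub_sigma_algebra; exact: open_interior.
  by rewrite -[X in measurable X]setTI; apply: mg => //; exact: measurable_ball.
apply/seteqP; split=> [x|x [q _ [/interior_subset Vx gx]]]; last first.
  by rewrite /= in_itv/= andbT; exact: Vx.
rewrite /= in_itv/= andbT => xr.
have [[A B] /= [Ax Bx] ABU] : nbhs (x, g x) U by exact: open_nbhs_nbhs.
have [c [q [cx cB]]] : exists c q,
  let C : set R := ball (ratr c : R) (ratr q) in g x \in C /\ C `<=` interior B.
  by apply: open_subball_rat; [exact: open_interior|exact: mem_set].
exists (c, q) => //; split; last exact/set_mem.
apply: filterS Ax => y Ay t /cB/interior_subset Bt; exact: (ABU (y, t)).
Qed.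

(** The previous lemma on [Om * Y], with [g] read as a function of the pair. The projection pulls
    Borel sets back to Borel sets of the product topology because it does so for open sets. *)
Lemma L0_loss (R : realType) (Om Y : ptopologicalType)
    (L : Om -> Y -> R -> R) (g : Om -> R) :
  continuous (fun p : Om * Y * R => L p.1.1 p.1.2 p.2) -> L0 g ->
  L0 (fun z : Om * Y => L z.1 z.2 (g z.1)).
Proof.
move=> cL Lg.
pose OmY : ptopologicalType := HB.pack (Om * Y)%type
  (isPointed.Build (Om * Y)%type (point, point)).
have := @measurable_continuous_graph R OmY
  (fun p : Om * Y * R => L p.1.1 p.1.2 p.2) (g \o fst) cL; apply.
move=> A mA; rewrite comp_preimage.
have : <<s @open Om >> (g @^-1` A) by exact: Lg.
pose S : set (set Om) := [set B | <<s @open (Om * Y)%type >> (fst @^-1` B)].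
apply: (@smallest_sub _ _ _ S).
  split.
  - by rewrite /S /= preimage_set0; exact: (@measurable0 _ (borel (Om * Y)%type)).
  - move=> B SB; rewrite /S /= setTD preimage_setC.
    exact: (@measurableC _ (borel (Om * Y)%type)).
  - move=> B SB; rewrite /S /= preimage_bigcup.
    exact: (@bigcupT_measurable _ (borel (Om * Y)%type)).
move=> B oB; apply: sub_sigma_algebra.
have /continuousP : continuous (@fst Om Y) by move=> p; exact: cvg_fst.
exact.
Qed.

(** * Finite nets from compactness of the kernel set *)

Lemma dual_apply_le (R : realType) (V : normedModType R) (G : dual V) (f : V) :
  `|G f| <= `|G| * `|f|.
Proof.
have lG := dual_linear G.
pose G' : {linear V -> R^o} := HB.pack (G : V -> R^o)
  (GRing.isLinear.Build _ _ _ _ _ lG).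
have [->|f0] := eqVneq f 0.
  by rewrite (linear0 G' : G 0 = 0) !normr0 mulr0.
have nf0 : 0 < `|f| by rewrite normr_gt0.
have := @dual_norm_ge _ _ G (`|f|^-1 *: f).
rewrite [G _](linearZ_LR G') normrZ normfV normr_id mulVf ?gt_eqF//.
move=> /(_ (lexx _)); rewrite normrM normfV normr_id.
by rewrite mulrC ler_pdivrMr.
Qed.

(** Total boundedness of the ball for the uniform distance on [A]. Finitely many functionals
    approximate [A]; their values on the ball are bounded, so rounding them sorts the ball into
    finitely many classes, and one representative per class gives the net. *)
Lemma compact_dual_net (R : realType) (V : normedModType R) (A : set (dual V))
    (M e : R) : compact A -> 0 < M -> 0 < e ->
  exists n (c : 'I_n -> V), (forall i, `|c i| <= M) /\
    forall f, `|f| <= M ->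
      exists i, forall G, A G -> `|(G f : R) - G (c i)| <= e.
Proof.
(* On the ball, functionals at distance less than [dl] differ by at most [dl * M = e / 4]. Two such
   replacements and a grid of step [w = e / 2] add up to [e]. *)
move=> cA M0 e0; pose dl := e / (4 * M).
have dl0 : 0 < dl by rewrite divr_gt0// mulr_gt0.
move: cA; rewrite compact_cover => /(_ _ A (fun G => ball G dl)) [].
- by move=> G _; exact: ball_open.
- by move=> G AG; exists G => //; exact: ballxx.
move=> D DA Acov.
pose C : R := \sum_(G <- enum_fset D) `|G| * M.
have GC (G : dual V) f : G \in D -> `|f| <= M -> `|G f : R| <= C.
  move=> GD fM; apply: le_trans (dual_apply_le _ _) _.
  apply: (@le_trans _ _ (`|G| * M)); first by rewrite ler_wpM2l.
  rewrite /C (big_rem G)//= lerDl sumr_ge0// => H _.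
  by rewrite mulr_ge0// ltW.
have [w w0 we] : exists2 w, 0 < w & w = e / 2.
  by exists (e / 2) => //; rewrite divr_gt0.
(* The values lie in [[-C, C]]; shifted by [C] and divided by [w], they have integer parts from 0 to
   [k], so [inord] below does not truncate. *)
pose k := Num.truncn (2 * C / w).
pose lvl (G : dual V) f := Num.truncn (((G f : R) + C) / w).
pose code f : {ffun D -> 'I_k.+1} := [ffun G => inord (lvl (val G) f)].
have lvl_nonneg (G : dual V) f : G \in D -> `|f| <= M ->
    0 <= ((G f : R) + C) / w.
  move=> GD fM; apply: divr_ge0; last exact: ltW.
  by have := GC _ _ GD fM; rewrite ler_norml => /andP[]; lra.
have lvlk (G : dual V) f : G \in D -> `|f| <= M -> (lvl G f <= k)%N.
  move=> GD fM; apply: le_truncn; rewrite ler_pM2r ?invr_gt0//.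
  by have := GC _ _ GD fM; rewrite ler_norml => /andP[]; lra.
have code_close f g (G : dual V) : `|f| <= M -> `|g| <= M -> code f = code g ->
    G \in D -> `|(G f : R) - G g| <= w.
  move=> fM gM /ffunP fg GD; have := fg [` GD]%fset; rewrite !ffunE/=.
  move=> /(congr1 (@nat_of_ord _)); rewrite !inordK ?ltnS ?lvlk// => lfg.
  have /andP[f1 f2] := truncn_itv (lvl_nonneg _ _ GD fM).
  have /andP[g1 g2] := truncn_itv (lvl_nonneg _ _ GD gM).
  move: f1 f2 g1 g2; rewrite -/(lvl G f) -/(lvl G g) lfg.
  rewrite !ler_pdivlMr// !ltr_pdivrMr// -natr1 mulrDl mul1r ler_norml.
  by move=> *; apply/andP; split; lra.
pose good (i : 'I_#|{ffun D -> 'I_k.+1}|) :=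
  [set f : V | `|f| <= M /\ code f = enum_val i].
(* A code met by no vector of the ball gets the default 0, which keeps every center in the ball. *)
exists #|{ffun D -> 'I_k.+1}|, (fun i => xget 0 (good i)); split.
  by move=> i; case: xgetP => [f _ []//|_]; rewrite normr0 ltW.
move=> f fM; exists (enum_rank (code f)) => G AG.
have gf : good (enum_rank (code f)) f by split => //; rewrite enum_rankK.
have [gM cg] := xgetI 0 gf; set g := xget _ _ in gM cg *.
rewrite enum_rankK in cg.
have [G0 G0D GG0] := Acov _ AG.
have d1 (h : V) : `|h| <= M -> `|(G0 h : R) - G h| <= e / 4.
  move=> hM; apply: le_trans (dual_apply_le (G0 - G) h) _.
  have -> : e / 4 = dl * M by rewrite /dl; field; rewrite gt_eqF.
  by rewrite ler_pM// ltW//; move: GG0; rewrite -ball_normE.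
have d2 : `|(G0 f : R) - G0 g| <= w by apply: code_close.
have -> : (G f : R) - G g = - (G0 f - G f) + (G0 f - G0 g) + (G0 g - G g).
  by move: (G f) (G g) (G0 f) (G0 g) => a b c d; ring.
apply: le_trans (ler_normD _ _) _.
have := ler_normD (- (G0 f - G f)) (G0 f - G0 g); rewrite normrN.
have := d1 _ fM; have := d1 _ gM; move: d2; rewrite we; lra.
Qed.

(** Point evaluations are members of the kernel set, so estimates uniform over that set become
    uniform over [Om]. *)
Lemma right_kernel_setP (R : realType) (Om Om' : topologicalType)
    (B : completeNormedModType R) (evB : B -> (Om -> R^o))
    (F : normedModType R) (evF : F -> (Om' -> R^o)) (iota : F -> dual B)
    (K : Om * Om' -> R) (x : Om) :
  right_sided_RKBS evB evF iota K ->
  exists2 G, right_kernel_set evF iota K G & forall f, G f = evB f x.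
Proof.
move=> /rkbs_reproducing/(_ x)[g gK gf]; exists (iota g) => //.
by exists g => //; exists x.
Qed.

(** A compact kernel set is bounded in norm, which bounds all the values of [f] by one constant
    times its norm. *)
Lemma rkbs_linf (R : realType) (Om : ptopologicalType) (Om' : topologicalType)
    (B : completeNormedModType R) (evB : B -> (Om -> R^o))
    (F : normedModType R) (evF : F -> (Om' -> R^o)) (iota : F -> dual B)
    (K : Om * Om' -> R) (f : B) :
  right_sided_RKBS evB evF iota K -> compact (right_kernel_set evF iota K) ->
  exists g : Linfty R Om, evB f = g.
Proof.
move=> rkbsB compK.
suff h : evB f \in @linf_pred R Om by exists (MkLinfty h).
apply/mem_set; split; first by have [_ _] := rkbs_B rkbsB; exact.
have [c [_ cK]] := compact_bounded compK.
exists ((c + 1) * `|f|); split=> [|r /ltW cr x _ /=]; first exact: num_real.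
apply: le_trans cr; have [G KG <-] := right_kernel_setP x rkbsB.
apply: le_trans (dual_apply_le _ _) _; rewrite ler_wpM2r//.
by apply: cK => //; rewrite ltrDl.
Qed.

(** An [e / 2]-net of the ball comes from [compact_dual_net]; the other half of [e] pays for passing
    to the closure. *)
Lemma covers_E_M (R : realType) (Om : ptopologicalType) (Om' : topologicalType)
    (B : completeNormedModType R) (evB : B -> (Om -> R^o))
    (F : normedModType R) (evF : F -> (Om' -> R^o)) (iota : F -> dual B)
    (K : Om * Om' -> R) (M e : R) :
  right_sided_RKBS evB evF iota K -> compact (right_kernel_set evF iota K) ->
  0 < M -> 0 < e -> exists n, covers (E_M evB M) e n.
Proof.
move=> rkbsB compK M0 e0; have e20 : 0 < e / 2 by rewrite divr_gt0.
have [n [c [cM cnet]]] := compact_dual_net compK M0 e20.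
have [C evC] : {C : B -> Linfty R Om & forall b, evB b = C b}.
  apply: (@choice _ _ (fun b g => evB b = linf_fun g)) => b.
  exact: rkbs_linf rkbsB compK.
exists n, (C \o c) => f Ef.
have [g [[b bM bg] fg]] := Ef _ (nbhsx_ballx f _ e20).
have [i ci] := cnet b bM; exists i => /=.
rewrite (splitr e) -(subrK g (C (c i))) -addrA.
apply: le_trans (ler_normD _ _) _; apply: lerD; last first.
  by rewrite distrC; move: fg; rewrite -ball_normE => /ltW.
apply: linf_norm_le => x.
rewrite -[(_ - g) x]/(C (c i) x - g x) -evC -bg distrC.
by have [G KG Gx] := right_kernel_setP x rkbsB; rewrite -!Gx; exact: ci.
Qed.

(** One finite cover makes a least size exist, so [covering_number] does not fall back on its
    default. *)
Lemma covers_covering_number (R : realType) (V : normedModType R) (E : set V)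
    (e : R) (n : nat) : covers E e n -> covers E e (covering_number E e).
Proof.
move=> En; rewrite /covering_number; case: xgetP => [m _ []//|].
have ex : exists k, `[< covers E e k >] by exists n; exact/asboolP.
move=> /(_ (ex_minn ex)); case: ex_minnP => m /asboolP Em mmin []; split=> // k.
by move/asboolP; exact: mmin.
Qed.

Lemma covers_has_ubound (R : realType) (V : normedModType R) (E : set V)
    (e : R) (n : nat) : covers E e n -> has_ubound [set `|f| | f in E].
Proof.
move=> [c cE]; exists (\sum_(i < n) `|c i| + e) => _ [f /cE[i fi] <-].
rewrite -(subrK (c i) f) addrC; apply: le_trans (ler_normD _ _) _.
rewrite lerD 1?distrC// (bigD1 i)//= lerDl; exact: sumr_ge0.
Qed.

(** * The constants of the loss as genuine bounds *)

Lemma le_linf_Cinf (R : realType) (Om : ptopologicalType) (B : normedModType R)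
    (evB : B -> (Om -> R^o)) (M : R) (f : Linfty R Om) (x : Om) :
  has_ubound [set `|g| | g in E_M evB M] -> E_M evB M f ->
  `|f x : R| <= Cinf evB M.
Proof.
move=> hE Ef; apply: le_trans (linf_norm_ge f x) _.
apply: sup_upper_bound; last by exists f.
by split=> //; exists `|f|, f.
Qed.

(** [sup] is 0 on a set without supremum, so positivity of [loss_sup] forces the set of losses to be
    bounded. *)
Lemma loss_bound (R : realType) (Om Y : ptopologicalType) (B : normedModType R)
    (evB : B -> (Om -> R^o)) (L : Om -> Y -> R -> R) (M : R) x y t :
  0 < loss_sup evB L M -> `|t| <= Cinf evB M -> L x y t <= loss_sup evB L M.
Proof.
move=> rho0 tC; apply: sup_upper_bound; last first.
  by exists x, y, t; split => //; rewrite in_itv/= -ler_norml.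
apply: contrapT => /sup_out h.
by move: rho0; rewrite /loss_sup h ltxx.
Qed.

(** [inf] of the empty set is 0, so positivity provides some Lipschitz constant. The difference
    quotient is a lower bound of all of them, hence of their infimum. *)
Lemma loss_lipschitz (R : realType) (Om Y : ptopologicalType)
    (B : normedModType R) (evB : B -> (Om -> R^o)) (L : Om -> Y -> R -> R)
    (M : R) x y t1 t2 :
  0 < lip_const evB L M -> `|t1| <= Cinf evB M -> `|t2| <= Cinf evB M ->
  `|L x y t1 - L x y t2| <= lip_const evB L M * `|t1 - t2|.
Proof.
move=> Ups0 t1C t2C; have [->|t12] := eqVneq t1 t2.
  by rewrite !subrr normr0 mulr0.
have d0 : 0 < `|t1 - t2| by rewrite normr_gt0 subr_eq0.
rewrite -ler_pdivrMr//; apply: lb_le_inf.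
  apply/set0P; apply/negP => /eqP S0.
  by move: Ups0; rewrite /lip_const S0 inf0 ltxx.
move=> c [_ cL]; rewrite ler_pdivrMr//.
by apply: cL; rewrite in_itv/= -ler_norml.
Qed.

Lemma measure_bigsetU_le d (T : measurableType d) (R : realType)
    (mu : {measure set T -> \bar R}) (n : nat) (D : 'I_n -> set T) :
  (forall i, measurable (D i)) ->
  (mu (\big[setU/set0]_(i < n) D i) <= \sum_(i < n) mu (D i))%E.
Proof.
move=> mD.
(* Measurability is carried through the induction because subadditivity for two sets requires it. *)
apply: (proj2 (_ : measurable (\big[setU/set0]_(i < n) D i) /\ _)).
pose Q (A : set T) (v : \bar R) := measurable A /\ (mu A <= v)%E.
apply: (@big_ind2 _ _ Q) => //; first by split => //; rewrite measure0.
move=> A v A' v' [mA Av] [mA' Av']; split; first exact: measurableU.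
by apply: (le_trans (measureU2 _ mA mA')); exact: leeD.
Qed.

(** * Risks and their deviations for functions bounded by [C] *)

Section bounded_risk.
Variables (R : realType) (Om Y : ptopologicalType).
Variables (P : probability (borel (Om * Y)%type) R) (L : Om -> Y -> R -> R).
Variables (C rho Ups : R).
Hypothesis L_continuous : continuous (fun p : Om * Y * R => L p.1.1 p.1.2 p.2).
Hypothesis L_ge0 : forall x y t, 0 <= L x y t.
Hypothesis L_le : forall x y t, `|t| <= C -> L x y t <= rho.
Hypothesis L_lip : forall x y t1 t2, `|t1| <= C -> `|t2| <= C ->
  `|L x y t1 - L x y t2| <= Ups * `|t1 - t2|.

Definition loss_of (g : Om -> R) (z : borel (Om * Y)%type) : R :=
  L (z : Om * Y).1 (z : Om * Y).2 (g (z : Om * Y).1).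

(** Real-valued form of [risk]; [risk_mean_loss] identifies the two on measurable functions bounded
    by [C]. *)
Definition mean_loss (g : Om -> R) : R := (\int[P]_z loss_of g z)%R.

Lemma loss_of_measurable (g : Om -> R) : L0 g -> measurable_fun setT (loss_of g).
Proof.
by move=> Lg _ A mA; rewrite setTI; exact: (L0_loss L_continuous Lg).
Qed.

Lemma loss_of_integrable (g : Om -> R) : L0 g -> (forall x, `|g x| <= C) ->
  P.-integrable setT (EFin \o loss_of g).
Proof.
move=> Lg gC; apply: measurable_bounded_integrable => //.
- by rewrite /= probability_setT ltry.
- exact: loss_of_measurable.
exists rho; split=> [|r /ltW rhor z _ /=]; first exact: num_real.
by rewrite ger0_norm ?L_ge0// (le_trans _ rhor)// L_le.
Qed.

Lemma risk_mean_loss (g : Om -> R) : L0 g -> (forall x, `|g x| <= C) ->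
  risk L P g = (mean_loss g)%:E.
Proof.
move=> Lg gC; rewrite /mean_loss /Rintegral fineK//.
exact: integrable_fin_num (loss_of_integrable Lg gC).
Qed.

Lemma mean_loss_lipschitz (f g : Om -> R) (e : R) : 0 <= Ups ->
  L0 f -> (forall x, `|f x| <= C) -> L0 g -> (forall x, `|g x| <= C) ->
  (forall x, `|f x - g x| <= e) -> mean_loss f <= mean_loss g + Ups * e.
Proof.
move=> Ups0 Lf fC Lg gC fg.
have ic : P.-integrable setT (EFin \o cst (Ups * e)).
  exact: finite_measure_integrable_cst.
have -> : mean_loss g + Ups * e = (\int[P]_z (loss_of g z + cst (Ups * e) z))%R.
  rewrite RintegralD//; last exact: loss_of_integrable.
  by rewrite Rintegral_cst//= probability_setT mulr1.
apply: le_Rintegral => //; first exact: loss_of_integrable.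
  by apply: (integrableD _ (loss_of_integrable Lg gC) ic).
move=> z _; rewrite -lerBlDl; apply: le_trans (ler_norm _) _.
by apply: le_trans (L_lip _ _ (fC _) (gC _)) _; rewrite ler_wpM2l.
Qed.

Lemma emp_risk_lipschitz (N : nat) (z : N.-tuple (Om * Y))
    (f g : Om -> R) (e : R) :
  (0 < N)%N -> 0 <= Ups -> (forall x, `|f x| <= C) -> (forall x, `|g x| <= C) ->
  (forall x, `|f x - g x| <= e) -> emp_risk L z f <= emp_risk L z g + Ups * e.
Proof.
move=> N0 Ups0 fC gC fg.
have N0' : 0 < N%:R :> R by rewrite ltr0n.
have -> : Ups * e = N%:R^-1 * \sum_(k < N) (Ups * e).
  by rewrite sumr_const card_ord -[X in _^-1 * X]mulr_natl mulKf ?gt_eqF.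
rewrite /emp_risk -mulrDr -big_split/= ler_wpM2l ?invr_ge0 ?(ltW N0')//.
apply: ler_sum => k _; rewrite -lerBlDl; apply: le_trans (ler_norm _) _.
by apply: le_trans (L_lip _ _ (fC _) (gC _)) _; rewrite ler_wpM2l.
Qed.

(** Hoeffding for the single variable [loss_of f - loss_of g]: both losses lie in [[0, rho]], so
    their difference lies in [[-rho, rho]]. *)
Lemma excess_risk_deviation (N : nat) (f g : Om -> R) (t : R) :
  (0 < N)%N -> 0 < t -> 0 < rho ->
  L0 f -> (forall x, `|f x| <= C) -> L0 g -> (forall x, `|g x| <= C) ->
  let D := [set z : N.-tuple (borel (Om * Y)%type) | t <=
    (mean_loss f - mean_loss g) - (emp_risk L z f - emp_risk L z g)] in
  measurable D /\
  (power_measure P N D <= (expR (- (N%:R * t ^+ 2 / (2 * rho ^+ 2))))%:E)%E.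
Proof.
move=> N0 t0 rho0 Lf fC Lg gC D.
pose h z := loss_of f z - loss_of g z.
have mh : measurable_fun setT h.
  by apply: measurable_funB; exact: loss_of_measurable.
have hrho z : `|h z| <= rho.
  rewrite /h /loss_of ler_norml.
  have f1 := L_ge0 z.1 z.2 (f z.1); have f2 := L_le z.1 z.2 (fC z.1).
  have g1 := L_ge0 z.1 z.2 (g z.1); have g2 := L_le z.1 z.2 (gC z.1).
  by apply/andP; split; lra.
have eh : (\int[P]_z h z)%R = mean_loss f - mean_loss g.
  by rewrite RintegralB//; exact: loss_of_integrable.
have DE : D = [set z | t <= \int[P]_x h x - N%:R^-1 * \sum_(k < N) h (tnth z k)].
  apply/seteqP; split=> z; rewrite /D /= eh /emp_risk -mulrBr -sumrB; exact.
split; last by rewrite DE; exact: hoeffding.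
rewrite DE -[X in measurable X]setTI; apply: measurable_fun_le => //.
by apply: measurable_funB => //; exact: measurable_empirical_mean.
Qed.

End bounded_risk.

(** * Clipping to [[-C, C]] *)

Lemma L0_clip (R : realType) (X : ptopologicalType) (C : R) (g : X -> R) :
  L0 g -> L0 (fun x => Num.max (- C) (Num.min C (g x))).
Proof.
move=> /L0E mg; apply/L0E; apply: measurable_maxr => //.
exact: measurable_minr.
Qed.

Lemma clip_le (R : realType) (C t : R) : 0 <= C ->
  `|Num.max (- C) (Num.min C t)| <= C.
Proof.
by move=> C0; rewrite ler_norml le_max lexx /= ge_max ge_min lexx /= andbT; lra.
Qed.

(** Clipping never moves [t] away from a point of [[-C, C]], so clipped centers still form a net. *)
Lemma dist_clip_le (R : realType) (C t u : R) : `|u| <= C ->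
  `|Num.max (- C) (Num.min C t) - u| <= `|t - u|.
Proof.
rewrite ler_norml => /andP[u1 u2].
have [Ct|tC] := leP C t.
  rewrite max_r; last lra.
  by rewrite !ger0_norm; lra.
have [tC'|tC'] := leP (- C) t => //.
by rewrite !ler0_norm; lra.
Qed.

(** * The union bound for the excess risk of the minimizer *)

Theorem proposition2p26 (R : realType)
  (Om Y : ptopologicalType) (Om' : topologicalType)
  (cOm : compact [set: Om]) (hOm : hausdorff_space Om)
  (cY : compact [set: Y]) (hY : hausdorff_space Y)
  (lcOm' : locally_compact [set: Om']) (hOm' : hausdorff_space Om')
  (P : probability (borel (Om * Y)%type) R)
  (B : completeNormedModType R) (evB : B -> (Om -> R^o))
  (F : normedModType R) (evF : F -> (Om' -> R^o)) (iota : F -> dual B)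
  (K : Om * Om' -> R)
  (rkbsB : right_sided_RKBS evB evF iota K)
  (reflB : reflexive_space B)
  (compK : compact (right_kernel_set evF iota K))
  (M : R) (M0 : 0 < M)
  (L : Om -> Y -> R -> R) (lossL : admissible_loss L)
  (Ups0 : 0 < lip_const evB L M) (rho0 : 0 < loss_sup evB L M)
  (N : nat) (N0 : (0 < N)%N)
  (s : N.-tuple (Om * Y) -> B)
  (s_min : forall z : N.-tuple (Om * Y), is_minimizer evB L z M (s z))
  (eps tau : R) (eps0 : 0 < eps) (tau0 : 0 < tau) :
  (extension (power_measure P N)
     [set z | opt_risk evB L P M + (kappa evB L N M eps tau)%:E
              <= risk L P (evB (s z))]
   <= (expR (- tau))%:E)%E.
Proof.
have [L_ge0 cL _ _ _] := lossL.
set C := Cinf evB M; set Ups := lip_const evB L M in Ups0 *.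
set rho := loss_sup evB L M in rho0 *.
have L_le x y t : `|t| <= C -> L x y t <= rho by exact: loss_bound.
have L_lip x y t1 t2 : `|t1| <= C -> `|t2| <= C ->
    `|L x y t1 - L x y t2| <= Ups * `|t1 - t2| by exact: loss_lipschitz.
have [n0 cov0] := covers_E_M rkbsB compK M0 eps0.
have hE := covers_has_ubound cov0.
have [c cE] := covers_covering_number cov0.
set n := covering_number _ _ in c cE.
have EC f x : E_M evB M f -> `|f x : R| <= C by exact: le_linf_Cinf.
have LL (f : Linfty R Om) : L0 (f : Om -> R) by have /set_mem[] := linf_funP f.
have ball_E b : `|b| <= M -> exists2 g : Linfty R Om, evB b = g &
    ball_in_Linfty evB M g.
  move=> bM; have [g bg] := rkbs_linf b rkbsB compK.
  by exists g => //; exists b.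
have bE g : ball_in_Linfty evB M g -> E_M evB M g by exact: subset_closure.
(* The ball contains the zero vector and [Om] has a point, so [C] dominates some absolute value. *)
have C0 : 0 <= C.
  have [|g _ /bE Eg] := ball_E 0; first by rewrite normr0 ltW.
  exact: le_trans (EC g point Eg).
have Ups0' := ltW Ups0.
pose r := mean_loss P L.
have riskE g : E_M evB M g -> risk L P g = (r g)%:E.
  by move=> Eg; apply: (risk_mean_loss P cL L_ge0 L_le (LL g)) => x; exact: EC.
have r_ge0 g : 0 <= r g by apply: Rintegral_ge0 => z _; exact: L_ge0.
(* Near-minimizers exist only for a finite infimum; here risks are nonnegative and [E_M] is
   nonempty. *)
have : opt_risk evB L P M \is a fin_num.
  rewrite ge0_fin_numE; last first.
    by apply: le_ereal_inf_tmp => _ [g Eg <-]; rewrite riskE// lee_fin.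
  have [|g _ /bE Eg] := ball_E 0; first by rewrite normr0 ltW.
  apply: le_lt_trans (ereal_inf_lbound _) (ltry (r g)).
  by rewrite -riskE//; exists g.
move=> /[dup] optf /lb_ereal_inf_adherent.
(* The budget [4 * eps * Ups] is spent once on the near-minimality of [g1], once on moving [g1] to
   [f0], and once each on replacing the minimizer by a center in the risk and in the empirical
   risk. *)
move=> /(_ (eps * Ups) (mulr_gt0 eps0 Ups0))[_ [g1 Eg1 <-]].
rewrite -/(opt_risk _ _ _ _) riskE// -(fineK optf); set o := fine _.
rewrite -EFinD lte_fin => g1o.
(* [s z] is optimal only over the ball, so the function it is compared with must lie in the ball and
   not merely in its closure. *)
have [f0 [Bf0 g1f0]] := Eg1 _ (nbhsx_ballx g1 _ eps0).
have Ef0 := bE _ Bf0.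
have f0o : r f0 <= o + 2 * (eps * Ups).
  have : r f0 <= r g1 + Ups * eps.
    apply: (mean_loss_lipschitz P cL L_ge0 L_le L_lip Ups0'
      (LL f0) _ (LL g1)) => x.
    - exact: EC.
    - exact: EC.
    - apply: le_trans (linf_norm_ge (f0 - g1) x) _.
      by move: g1f0; rewrite -ball_normE /= distrC => /ltW.
  lra.
have s_near z : exists i, forall x, `|evB (s z) x - c i x : R| <= eps.
  have [sM _] := s_min z; have [g -> /bE Eg] := ball_E _ sM.
  have [i ci] := cE g Eg; exists i => x.
  by rewrite distrC; exact: le_trans (linf_norm_ge (c i - g) x) _.
pose b i x := Num.max (- C) (Num.min C (c i x : R)).
have Lb i : L0 (b i) by exact: L0_clip.
have bC i x : `|b i x| <= C by exact: clip_le.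
(* [E_M] is nonempty, so [n] is at least 1 and its logarithm is nonnegative. *)
have n0' : (0 < n)%N.
  by have [i _] := cE f0 Ef0; exact: leq_ltn_trans (ltn_ord i).
pose t := rho * Num.sqrt ((2 * tau + 2 * ln n%:R) / N%:R).
have lnn : 0 <= ln (n%:R : R) by rewrite ln_ge0// ler1n.
have q0 : 0 < (2 * tau + 2 * ln (n%:R : R)) / N%:R.
  by rewrite divr_gt0 ?ltr0n//; lra.
have t0 : 0 < t by rewrite mulr_gt0 // sqrtr_gt0.
pose D i := [set z : N.-tuple (borel (Om * Y)%type) | t <=
  (r (b i) - r f0) - (emp_risk L z (b i) - emp_risk L z f0)].
have hD i : measurable (D i) /\
    (power_measure P N (D i) <=
     (expR (- (N%:R * t ^+ 2 / (2 * rho ^+ 2))))%:E)%E.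
  by apply: (excess_risk_deviation P cL L_ge0 L_le N0 t0 rho0 (Lb i) (bC i)
    (LL f0)) => x; exact: EC.
(* [t] is chosen so that [N * t ^+ 2 / (2 * rho ^+ 2) = tau + ln n]; the factor [1 / n] absorbs the
   union bound. *)
have expE : expR (- (N%:R * t ^+ 2 / (2 * rho ^+ 2))) = expR (- tau) / n%:R.
  have nE : n%:R = expR (ln n%:R) :> R by rewrite lnK// posrE ltr0n.
  rewrite [in RHS]nE -expRN -expRD; congr expR.
  rewrite /t exprMn sqr_sqrtr ?ltW//; field.
  by rewrite !gt_eqF ?ltr0n.
set A := [set z | _].
have AD : A `<=` \big[setU/set0]_(i < n) D i.
  move=> z; rewrite /A /= -EFinD.
  have [sM s_opt] := s_min z; have [g sg /bE Eg] := ball_E _ sM.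
  have [i si] := s_near z.
  rewrite sg in si *; rewrite riskE// lee_fin => hz.
  rewrite -bigcup_seq; exists i; first exact: mem_index_enum.
  have bi x : `|g x - b i x| <= eps.
    rewrite distrC; apply: le_trans (dist_clip_le _ (EC _ _ Eg)) _.
    by rewrite distrC.
  have ib x : `|b i x - g x| <= eps by rewrite distrC.
  have r1 : r g <= r (b i) + Ups * eps.
    by apply: (mean_loss_lipschitz P cL L_ge0 L_le L_lip Ups0'
      (LL g) _ (Lb i)) => // x; exact: EC.
  have e1 : emp_risk L z (b i) <= emp_risk L z g + Ups * eps.
    by apply: (emp_risk_lipschitz L_lip) => // x; exact: EC.
  have e2 : emp_risk L z g <= emp_risk L z f0.
    by have [b0 b0M <-] := Bf0; rewrite -sg; exact: s_opt.
  move: hz; rewrite /kappa -/rho -/Ups -/n -/t /D /= => hz.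
  by lra.
(* [A] depends on the selection [s], whose measurability is not assumed; the outer measure is
   monotone on all sets, and the union of the [D i] is measurable. *)
rewrite /extension; apply: le_trans; first by apply: le_mu_ext; exact: AD.
rewrite measurable_mu_extE; last first.
  by apply: bigsetU_measurable => i _; exact: (hD i).1.
apply: le_trans (measure_bigsetU_le _ _) _; first by move=> i; exact: (hD i).1.
apply: (@le_trans _ _ (\sum_(i < n) (expR (- tau) / n%:R)%:E)%E).
  by apply: lee_sum => i _; rewrite -expE; exact: (hD i).2.
rewrite sumEFin lee_fin sumr_const card_ord -[X in X <= _]mulr_natl.
by rewrite mulrCA mulfV ?mulr1// gt_eqF// ltr0n.
Qed.
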